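(* Let $T$ be a tree of height $\omega_1$ with a cofinal branch. Then $\diamondsuit$ implies $\diamondsuit_T$. Additionally, if $T$ is an $\omega_1$-tree, then $\diamondsuit$ and $\diamondsuit_T$ are equivalent.
   Context: A tree is a partial order $(T,<_T)$ in which the set of predecessors of each node is well-ordered; every tree is assumed to have a root, denoted $\emptyset$. For $t\in T$, $t{\downarrow}=\{s\in T\mid s<_T t\}$, $\mathrm{ht}(t)$ is the order type of $t{\downarrow}$, and $T_\alpha$ is the set of nodes of height $\alpha$. The height of $T$ is the least $\alpha$ with $T_\alpha=\emptyset$. An $\omega_1$-tree is a tree of height $\omega_1$ all of whose levels $T_\alpha$ are countable. An antichain is a set of pairwise incomparable nodes; a cofinal branch is a chain $B\subseteq T$ with $B\cap T_\alpha\neq\emptyset$ for all $\alpha<\mathrm{ht}(T)$. A set $U\subseteq T$ is special if it is a union of at most countably many antichains; otherwise it is nonspecial (a tree of height $\omega_1$ with a cofinal branch is nonspecial). For $X\subseteq T$, a map $f:X\to T$ is regressive if $f(t)<_T t$ for all $t\in X\setminus\{\emptyset\}$. For $T$ of height $\omega_1$, $NS^T$ is the ideal of all $B\subseteq T$ for which there is a regressive $f:B\to T$ such that $f^{-1}(\{t\})$ is special for every $t\in T$. For a nonspecial tree $T$ of height $\omega_1$, $\diamondsuit_T$ asserts that there is a sequence $(D_t\mid t\in T)$ with $D_t\subseteq t{\downarrow}$ for all $t\in T$ such that for every $X\subseteq T$, $\{t\in T\mid X\cap t{\downarrow}=D_t\}\notin NS^T$. $\diamondsuit$ is Jensen's principle: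 there is $(D_\alpha)_{\alpha<\omega_1}$ with $D_\alpha\subseteq\alpha$ such that for every $X\subseteq\omega_1$ the set $\{\alpha<\omega_1\mid X\cap\alpha=D_\alpha\}$ is stationary. *)

(* Defs.v *)
From HB Require Import structures.
From mathcomp Require Import all_boot all_order.
From mathcomp Require Import boolp classical_sets functions cardinality.
From mathcomp Require wochoice.

Set Implicit Arguments.
Unset Strict Implicit.
Unset Printing Implicit Defensive.

Import Order.TTheory.
Local Open Scope classical_set_scope.
Local Open Scope order_scope.

Definition below d (T : porderType d) (t : T) : set T := [set s | s < t].

(* [f] is total only for convenience, the codomain being inhabited in all uses;
   its values outside [A] are irrelevant. *)
Definition order_isomorphic d (X : porderType d) d' (Y : porderType d')
    (A : set X) (B : set Y) : Prop :=
  exists2 f : X -> Y, set_bij A B f & {in A &, {mono f : x y / x < y}}.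

(* Up to isomorphism, [W] is the ordinal omega_1; its elements play the role of
   the countable ordinals. *)
Definition is_omega1 d (W : orderType d) : Prop :=
  [/\ wochoice.well_order (<=%O : rel W),
      ~ countable [set: W]
    & forall a : W, countable (below a)].

(* The notion below is inhabited. *)
Lemma omega1_exists : exists d (W : orderType d), is_omega1 W.
Proof.
have [R0 woR0] := wochoice.well_ordering_principle (set nat).
have unc0 : ~ countable [set: set nat].
  move=> /countable_injP[f finj].
  pose D : set nat := [set n | exists A : set nat, f A = n /\ ~ A n].
  have [DfD|nDfD] := pselect (D (f D)).
    have [A [fA nA]] := DfD.
    by move: nA; rewrite (finj A D _ _ fA) ?in_setT.
  by apply: (nDfD); exists D.
have [S [R [woR uncR smallR]]] : exists (S : choiceType) (R : rel S),
    [/\ wochoice.well_order R, ~ countable [set: S] &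
        forall a, countable [set b | R b a && (b != a)]].
  pose seg (a : set nat) := [set b | R0 b a && (b != a)].
  pose big := [pred a : set nat | `[< ~ countable (seg a) >]].
  have [nbig|bigne] := pselect (forall a, ~ big a).
    exists (set nat), R0; split=> // a.
    by apply: contrapT => ca; apply: (nbig a); apply/asboolP.
  have [|m [[mbig mmin] _]] := woR0 big.
    by have /existsNP[a /contrapT ba] := bigne; exists a.
  have chR0 : wochoice.wo_chain R0 predT by move=> A _; exact: (woR0 A).
  have anti0 : antisymmetric R0.
    by move=> x y; exact: (wochoice.wo_chain_antisymmetric chR0 isT isT).
  pose S : choiceType := {b : set nat | R0 b m && (b != m)}.
  exists S, (relpre val R0); split.
  - apply: wochoice.antisymmetric_well_order.
      by move=> x y /anti0 /val_inj.
    move=> A [a Aa].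
    have [|z [[zA zmin] _]] := woR0 [pred x | `[< exists2 b, b \in A & val b = x >]].
      by exists (val a); apply/asboolP; exists a.
    move/asboolP: zA => [b Ab bz]; exists b; split=> // y Ay.
    by rewrite /= bz; apply: zmin; apply/asboolP; exists y.
  - move/asboolP: mbig => mbig cS; apply: mbig.
    rewrite (_ : seg m = [set val x | x in [set: S]]).
      exact: card_le_trans (card_image_le _ _) cS.
    apply/seteqP; split=> [b mb|_ [[b mb] _ <-]//].
    by exists (exist _ b mb).
  - move=> a; have ca : countable (seg (val a)).
      apply: contrapT => /asboolP /mmin ma; have /andP[am] := valP a.
      by move/eqP; apply; apply: anti0; rewrite am ma.
    have: val @` [set b : S | R0 (val b) (val a) && (b != a)] `<=` seg (val a).
      by move=> _ [b /andP[ba nba] <-]; rewrite /seg /= ba.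
    move/subset_card_le/card_le_trans => /(_ _ _ ca).
    by rewrite (card_le_eql (inj_card_eq _)) // => x y _ _; exact: val_inj.
have ch : wochoice.wo_chain R predT by move=> A _; exact: (woR A).
have tot : total R by move=> x y; exact: (wochoice.wo_chainW ch isT isT).
have anti : antisymmetric R.
  by move=> x y; exact: (wochoice.wo_chain_antisymmetric ch isT isT).
have trans : transitive R.
  move=> y x z xy yz.
  have [|w [[wA wmin] _]] := woR [pred u | (u == x) || (u == y) || (u == z)].
    by exists x; rewrite inE eqxx.
  have [wx wy wz] : [/\ R w x, R w y & R w z].
    by split; apply: wmin; rewrite inE eqxx ?orbT.
  move: wA; rewrite inE -orbA => /or3P[] /eqP ew; subst w => //.
    by rewrite (anti x y) // xy.
  by rewrite -(anti y z) // yz.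
pose lt x y := (y != x) && R x y.
have ltE x y : lt x y = (y != x) && R x y by [].
pose mn x y := if lt x y then x else y.
pose mx x y := if lt x y then y else x.
have mnE x y : mn x y = if lt x y then x else y by [].
have mxE x y : mx x y = if lt x y then y else x by [].
pose S2 : choiceType := Choice.Pack (Choice.class S).
pose mix := Order.isOrder.Build (Order.Disp tt tt) S2 ltE mnE mxE anti trans tot.
pose W : orderType (Order.Disp tt tt) := HB.pack S2 mix.
exists (Order.Disp tt tt), W; split=> // a.
apply: sub_countable (smallR a); apply: subset_card_le => b /= ba.
by have := ba; rewrite /below /= lt_def eq_sym andbC.
Qed.

(* The root of the tree is [\bot]. *)
Definition is_tree d (T : bPOrderType d) : Prop :=
  forall t : T, wochoice.wo_chain <=%O [pred s | s < t].

(* The nodes of height [a], where [a] stands for the order type of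
   [below a]. *)
Definition level d (T : porderType d) d' (W : orderType d') (a : W) : set T :=
  [set t | order_isomorphic (below t) (below a)].
Arguments level {d} T {d' W} a.

(* The least ordinal [a] such that the level [a] of [T] is empty is the order
   type of [W]: levels of index smaller than the order type of [W] are
   nonempty, and no node has height the order type of [W]. *)
Definition has_height d (T : porderType d) d' (W : orderType d') : Prop :=
  (forall a : W, level T a !=set0) /\
  (forall t : T, ~ order_isomorphic (below t) [set: W]).

(* For [T] of height (the order type of) [W]. *)
Definition cofinal_branch d (T : porderType d) d' (W : orderType d')
    (B : set T) : Prop :=
  total_on B (fun s t => s <= t) /\ forall a : W, B `&` level T a !=set0.

Definition is_omega1_tree d (T : bPOrderType d) d' (W : orderType d') : Prop :=
  [/\ is_tree T, has_height T W & forall a : W, countable (level T a)].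

Definition antichain d (T : porderType d) (A : set T) : Prop :=
  forall s t, A s -> A t -> s != t -> s >< t.

Definition special d (T : porderType d) (U : set T) : Prop :=
  exists2 A : nat -> set T, forall n, antichain (A n) & U = \bigcup_n A n.

(* The values of [f] outside [X] are irrelevant. *)
Definition regressive d (T : bPOrderType d) (X : set T) (f : T -> T) : Prop :=
  forall t, X t -> t != \bot -> f t < t.

Definition NS d (T : bPOrderType d) : set (set T) :=
  [set B | exists2 f : T -> T, regressive B f &
             forall t, special (B `&` f @^-1` [set t])].
Arguments NS {d} T _.

Definition tree_diamond d (T : bPOrderType d) : Prop :=
  exists2 D : T -> set T, forall t, D t `<=` below t &
    forall X : set T, ~ NS T [set t | X `&` below t = D t].

Definition club d (W : orderType d) (C : set W) : Prop :=
  (forall a, exists2 c, C c & a <= c) /\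
  (forall a, C `&` below a !=set0 -> supremums (C `&` below a) a -> C a).

Definition stationary d (W : orderType d) (S : set W) : Prop :=
  forall C, club C -> S `&` C !=set0.

Definition diamond d (W : orderType d) : Prop :=
  exists2 D : W -> set W, forall a, D a `<=` below a &
    forall X : set W, stationary [set a | X `&` below a = D a].

(* Main.v *)
(* From diamond to the tree: transport the guesses along the height function. An
   antichain meets the cofinal branch in at most one node, so a regressive map
   with special fibres would induce, through the branch, a regressive map with
   countable fibres on a stationary set of countable ordinals.
   Conversely, when levels are countable, the guesses at the nodes of height [a]
   form a countable family of guesses at [a], and Kunen's argument extracts a
   diamond sequence from these families. A set of nodes whose heights avoid a club
   [C] is in the ideal: send [t] to a node below it above all of [C] below the
   height of [t]; each fibre then has bounded height. *)
Require Import Defs.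
From mathcomp Require Import all_boot all_order.
From mathcomp Require Import boolp classical_sets functions cardinality.
From mathcomp Require wochoice.

Set Implicit Arguments.
Unset Strict Implicit.
Unset Printing Implicit Defensive.

Import Order.TTheory.
Local Open Scope classical_set_scope.
Local Open Scope order_scope.

(** * Minima in well-ordered chains, and countable sets *)

Lemma wo_chain_min d (T : porderType d) (C : {pred T}) (A : set T) :
  wochoice.wo_chain <=%O C -> A !=set0 -> (forall x, A x -> x \in C) ->
  exists2 m, A m & forall x, A x -> m <= x.
Proof.
move=> woC [a Aa] AC.
have [||m [[/asboolP Am mmin] _]] := woC [pred x | `[< A x >]].
- by move=> x /asboolP /AC.
- by exists a; apply/asboolP.
- by exists m => // x Ax; apply: mmin; apply/asboolP.
Qed.

Lemma countable_enum T (A : set T) :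
  countable A -> A !=set0 -> exists e : nat -> T, forall x, A x -> exists n, e n = x.
Proof.
move=> /countable_injP[f finj] [a0 Aa0].
have /choice[e eP] n : exists x, (exists2 y, A y & f y = n) -> A x /\ f x = n.
  have [[y Ay fy]|no] := pselect (exists2 y, A y & f y = n); first by exists y.
  by exists a0 => /no.
exists e => x Ax; exists (f x).
have [|Ae fe] := eP (f x); first by exists x.
by apply: finj => //; exact: mem_set.
Qed.

Lemma countableU T (A B : set T) :
  countable A -> countable B -> countable (A `|` B).
Proof.
move=> cA cB; rewrite -bigcup2E; apply: bigcup_countable => // -[|[|n]] _ //=.
Qed.

(** * Bounds, ranks and clubs in the first uncountable ordinal *)

Definition strict_ub d (W : orderType d) (S : set W) : set W :=
  [set u | forall x, S x -> x < u].

Section Omega1.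
Context d (W : orderType d) (hW : is_omega1 W).
Implicit Types (a b c : W) (S C : set W).

Lemma omega1_min S : S !=set0 -> exists2 m, S m & forall x, S x -> m <= x.
Proof.
by case: hW => wo _ _ S0; apply: (@wo_chain_min _ _ predT) => // A _; exact: wo.
Qed.

Lemma omega1_ind (P : W -> Prop) :
  (forall a, (forall b, b < a -> P b) -> P a) -> forall a, P a.
Proof.
move=> IH a; apply: contrapT => nPa.
have [|m nPm mmin] := @omega1_min [set x | ~ P x]; first by exists a.
apply: nPm; apply: IH => b bm; apply: contrapT => /mmin.
by rewrite leNgt bm.
Qed.

Lemma omega1_wf : well_founded (fun a b : W => a < b).
Proof. by move=> a; elim/omega1_ind: a => a IH; constructor. Qed.

Lemma below_countable a : countable (below a).
Proof. by case: hW. Qed.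

(** Otherwise the countable segments up to the elements of [S], countably many, would cover [W]. *)
Lemma countable_strict_ub S : countable S -> strict_ub S !=set0.
Proof.
move=> cS; apply: contrapT => nub; case: hW => _ + _; apply.
have -> : [set: W] = \bigcup_(x in S) (below x `|` [set x]).
  apply/seteqP; split=> // a _; apply: contrapT => na; apply: nub; exists a.
  move=> x Sx; rewrite ltNge le_eqVlt; apply/negP => /orP ax.
  apply: na; exists x => //; case: ax => [/eqP|]; first by right.
  by left.
apply: bigcup_countable => // x _.
exact: countableU (below_countable _) (countable1 _).
Qed.

Lemma lt_exists a : exists b, a < b.
Proof.
by have [b ub] := countable_strict_ub (countable1 a); exists b; exact: ub.
Qed.

Lemma eq_below a b : below a = below b -> a = b.
Proof.
move=> ab; case: (ltgtP a b) => // lt.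
- by have : below a a; [rewrite ab|rewrite /below /= ltxx].
- by have : below b b; [rewrite -ab|rewrite /below /= ltxx].
Qed.

(** Well-founded recursion through a choice of least strict upper bounds. The conclusion is
    conditional because the values at the predecessors of a point may be unbounded in [W]. It serves
    both for pairs and for tree nodes. *)
Lemma rank_exists A (R : A -> A -> Prop) : well_founded R ->
  exists h : A -> W, forall x, strict_ub (h @` [set y | R y x]) !=set0 ->
    strict_ub (h @` [set y | R y x]) (h x) /\
    forall v, strict_ub (h @` [set y | R y x]) v -> h x <= v.
Proof.
move=> wfR.
have [w0 _] := countable_strict_ub (@countable0 W).
have /choice[G GP] (S : set W) : exists u, strict_ub S !=set0 ->
    strict_ub S u /\ forall v, strict_ub S v -> u <= v.
  have [/omega1_min[u Su umin]|no] := pselect (strict_ub S !=set0).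
    by exists u.
  by exists w0 => /no.
pose F x (g : forall y, R y x -> W) := G [set w | exists y (r : R y x), g y r = w].
pose h := Fix wfR (fun=> W) F.
have hE x : h x = G (h @` [set y | R y x]).
  rewrite /h Fix_eq => [|y f g fg]; rewrite /F.
  - congr G; apply/seteqP; split=> [_ [y [r <-]]|_ [y r <-]]; first by exists y.
    by exists y, r.
  - congr G; apply/seteqP; split=> [_ [z [r <-]]|_ [z [r <-]]]; exists z, r;
    by rewrite fg.
by exists h => x; rewrite hE; exact: GP.
Qed.

(* The rank function of the lexicographic order on [W * nat] is injective. *)
Lemma coding_exists : exists e : W * nat -> W, injective e.
Proof.
pose R (p q : W * nat) := p.1 < q.1 \/ p.1 = q.1 /\ (p.2 < q.2)%N.
have wfR : well_founded R.
  case=> a; elim/omega1_ind: a => a IHa n.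
  elim/ltn_ind: n => n IHn; constructor=> -[b m] [/= ba|/= [-> mn]].
    exact: IHa.
  exact: IHn.
have [e eP] := rank_exists wfR; exists e.
have emono p q : R p q -> e p < e q.
  move=> Rpq; have [|+ _] := eP q; last by apply; exists p.
  apply: countable_strict_ub; apply: card_le_trans (card_image_le _ _) _.
  have [c qc] := lt_exists q.1.
  apply: sub_countable (countableX (below_countable c) (@countableP nat setT)).
  apply: subset_card_le => -[b m] [/= bq|/= [-> _]]; split=> //=.
  exact: lt_trans qc.
move=> [a n] [b m] eab.
have irr p q : e p = e q -> ~ R p q by move=> epq /emono; rewrite epq ltxx.
case: (ltgtP a b) => [ab|ba|ab].
- by case: (irr _ _ eab); left.
- by case: (irr _ _ (esym eab)); left.
- subst b; case: (ltngtP n m) => [nm|mn|-> //].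
    by case: (irr _ _ eab); right.
  by case: (irr _ _ (esym eab)); right.
Qed.

Lemma club_closure_points (a0 : W) (h : W -> W) :
  club [set a | a0 < a /\ forall b, b < a -> h b < a].
Proof.
split=> [a|a [c [[a0c _]] ca] [_ alub]].
  (* Unboundedness: [nx b] passes [a0], [b] and all values of [h] up to [b], so the supremum of its
     iterates is closed under [h]. *)
  have /choice[nx nxP] b : exists c, [/\ a0 < c, b < c & forall x, x <= b -> h x < c].
    pose S := a0 |` (b |` h @` (below b `|` [set b])).
    have [|c cP] := @countable_strict_ub S.
      do 2![apply: countableU (countable1 _) _].
      apply: card_le_trans (card_image_le _ _) _.
      exact: countableU (below_countable _) (countable1 _).
    exists c; split; [by apply: cP; left|by apply: cP; right; left|].
    move=> x; rewrite le_eqVlt => xb; apply: cP; right; right; exists x => //.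
    by case/orP: xb => [/eqP|]; [right|left].
  pose s n := iter n nx a.
  have [|c cub cmin] := @omega1_min (strict_ub (range s)).
    exact/countable_strict_ub/(card_le_trans (card_image_le _ _))/countableP.
  have sc n : s n < c by apply: cub; exists n.
  exists c; last exact: ltW (sc 0).
  split=> [|b bc].
    by apply: lt_trans (sc 1); case: (nxP a).
  have [n bn] : exists n, b <= s n.
    apply: contrapT => no; have : strict_ub (range s) b.
      by move=> _ [n _ <-]; rewrite ltNge; apply/negP => bs; apply: no; exists n.
    by move/cmin; rewrite leNgt bc.
  by apply: lt_trans (sc n.+1); case: (nxP (s n)) => _ _; apply.
split=> [|b ba]; first exact: lt_trans ca.
(* As [a] is a supremum of closure points, one of them lies strictly between [b] and [a]. *)
have [e [[_ eC] ea] be] : exists2 e,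
    [set a' | a0 < a' /\ forall b0, b0 < a' -> h b0 < a'] e /\ e < a & b < e.
  apply: contrapT => no; have : a <= b; last by rewrite leNgt ba.
  apply: alub => e [eC ea]; rewrite leNgt; apply/negP => be; apply: no.
  by exists e.
exact: lt_trans (eC _ be) ea.
Qed.

(** For unboundedness, a closure point of a function that jumps past a member of every [C n] is a
    limit of members of each [C n]. *)
Lemma club_bigcap (C : nat -> set W) :
  (forall n, club (C n)) -> club (\bigcap_n C n).
Proof.
move=> clubC; split=> [a|a [c [Cc ca]] [aub alub]].
  have /choice[h hP] x : exists u, forall n, exists c, [/\ C n c, x < c & c < u].
    have [y xy] := lt_exists x.
    have /choice[g gP] n : exists c, C n c /\ x < c.
      have [+ _] := clubC n; move/(_ y) => [c Cc yc].
      by exists c; split=> //; exact: lt_le_trans xy yc.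
    have [|u uP] := @countable_strict_ub (range g).
      exact/(card_le_trans (card_image_le _ _))/countableP.
    by exists u => n; have [? ?] := gP n; exists (g n); split=> //; apply: uP; exists n.
  have [+ _] := club_closure_points a h; move=> /(_ a)[c [ac cP] _].
  exists c; last exact: ltW.
  move=> n _; have [_ clos] := clubC n; apply: clos.
    have [e [Ce ae eh]] := hP a n.
    by exists e; split=> //; apply: lt_trans eh _; exact: cP.
  split=> [e [_ /ltW//]|u uub]; rewrite leNgt; apply/negP => uc.
  have [e [Ce ue eh]] := hP u n.
  have : e <= u; last by rewrite leNgt ue.
  by apply: uub; split=> //; apply: lt_trans eh _; exact: cP.
move=> n _; have [_ clos] := clubC n; apply: clos.
  by exists c; split=> //; exact: Cc.
split=> [e [_ /ltW//]|u uub]; apply: alub => e [Ce ea].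
by apply: uub; split=> //; exact: Ce.
Qed.

End Omega1.

(** * Heights of tree nodes as elements of [W] *)

Definition height_fun d (T : porderType d) d' (W : orderType d')
    (h : T -> W) : Prop :=
  [/\ {homo h : s t / s < t}, forall t, h @` below t = below (h t)
    & forall t a, level T a t <-> h t = a].

Section Tree.
Context dW (W : orderType dW) (hW : is_omega1 W).
Context dT (T : bPOrderType dT) (hT : is_tree T) (hheight : has_height T W).

Lemma tree_wf : well_founded (fun s t : T => s < t).
Proof.
move=> t; constructor=> s st; apply: contrapT => nacc.
have [||m [mt macc] mmin] := @wo_chain_min _ _ [pred s | s < t]
    [set s | s < t /\ ~ Acc (fun s t : T => s < t) s] (@hT t).
- by exists s.
- by move=> x [].
apply: macc; constructor=> u um; apply: contrapT => nu.
suff mu : m <= u by have := lt_le_trans um mu; rewrite ltxx.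
by apply: mmin; split=> //; exact: lt_trans mt.
Qed.

Lemma below_comparable (t x y : T) : x < t -> y < t -> (x <= y) || (y <= x).
Proof. by move=> xt yt; apply: (wochoice.wo_chainW (@hT t)). Qed.

(** The rank function of the tree order works: the predecessors of a node form a chain, and their
    ranks leave no gaps. *)
Lemma height_exists : exists h : T -> W, height_fun h.
Proof.
have [h hP] := rank_exists hW tree_wf; exists h.
pose good t := (forall s, s < t -> h s < h t) /\ h @` below t = below (h t).
have allgood t : good t.
  elim: (tree_wf t) => {}t _ IH.
  have img_init s a : s < t -> a < h s -> exists2 u, u < s & h u = a.
    by move=> st as_; have [_ ims] := IH s st; have : below (h s) a by []; rewrite -ims.
  have mono s u : s < t -> u < t -> (h s < h u) = (s < u).
    move=> st ut; apply/idP/idP => [|su]; last by have [+ _] := IH u ut; apply.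
    move=> hsu; have /orP[] := below_comparable st ut.
      by rewrite le_eqVlt => /orP[/eqP E|//]; move: hsu; rewrite E ltxx.
    rewrite le_eqVlt => /orP[/eqP E|us]; first by move: hsu; rewrite E ltxx.
    by have [/(_ _ us)] := IH s st; rewrite ltNge (ltW hsu).
  have inj s u : s < t -> u < t -> h s = h u -> s = u.
    move=> st ut hsu; have /orP[] := below_comparable st ut;
    rewrite le_eqVlt => /orP[/eqP //|]; rewrite -mono // hsu ltxx //.
  have [|hub hmin] := hP t.
    (* If the ranks below [t] were unbounded, then, having no gaps, they would make [h] an
       isomorphism from [below t] onto [W]. *)
    apply: contrapT => nub; case: hheight => _ /(_ t); apply; exists h.
    - split=> // [x y /set_mem xt /set_mem yt|a _]; first exact: inj.
      have [s st ahs] : exists2 s, s < t & a <= h s.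
        apply: contrapT => no; apply: nub; exists a => _ [s st <-].
        by rewrite ltNge; apply/negP => ahs; apply: no; exists s.
      move: ahs; rewrite le_eqVlt => /orP[/eqP->|/(img_init _ _ st)[u us <-]].
        by exists s.
      by exists u => //; exact: lt_trans st.
    - by move=> x y /set_mem xt /set_mem yt; exact: mono.
  split=> [s st|]; first by apply: hub; exists s.
  apply/seteqP; split=> [_ [s st <-]|a aht]; first by apply: hub; exists s.
  have [s st ahs] : exists2 s, s < t & a <= h s.
    apply: contrapT => no; suff : h t <= a by rewrite leNgt; move/negP; apply.
    apply: hmin => _ [s st <-].
    by rewrite ltNge; apply/negP => ahs; apply: no; exists s.
  move: ahs; rewrite le_eqVlt => /orP[/eqP->|/(img_init _ _ st)[u us <-]].
    by exists s.
  by exists u => //; exact: lt_trans st.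
have hmono : {homo h : s t / s < t} by move=> s t st; have [+ _] := allgood t; apply.
have him t : h @` below t = below (h t) by have [] := allgood t.
split=> // t a; split=> [[f [fP finj fsurj] fmono]|<-].
  (* An isomorphism onto an initial segment is unique, by induction along the predecessors of
     [t]. *)
  have fh s : s < t -> f s = h s.
    elim: (tree_wf s) => {}s _ IH st; apply: (eq_below (W := W)).
    rewrite -him; apply/seteqP; split=> [b bf|_ [u us <-]].
      have [u ut fu] : (f @` below t) b.
        by apply: fsurj; apply: lt_trans bf _; exact: fP.
      move: bf; rewrite /below /= -fu fmono ?inE // => us.
      by exists u => //; rewrite -IH.
    rewrite /below /= -IH //; last exact: lt_trans st.
    by rewrite fmono ?inE //; exact: lt_trans st.
  apply: (eq_below (W := W)); rewrite -him; apply/seteqP; split=> [_ [s st <-]|b ba].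
    by rewrite -fh //; exact: fP.
  by have [s st <-] := fsurj _ ba; exists s; rewrite ?fh.
exists h.
  split=> [s /hmono//|x y /set_mem xt /set_mem yt hxy|b]; last by rewrite -him.
  have /orP[] := below_comparable xt yt;
  by rewrite le_eqVlt => /orP[/eqP //|/hmono]; rewrite hxy ltxx.
move=> x y /set_mem xt /set_mem yt; apply/idP/idP => [hxy|]; last exact: hmono.
have /orP[] := below_comparable xt yt; rewrite le_eqVlt => /orP[/eqP E|//].
- by move: hxy; rewrite E ltxx.
- by move: hxy; rewrite E ltxx.
- by move=> /hmono; rewrite ltNge ltW.
Qed.

(** * Levels, special sets and the ideal *)

Context (h : T -> W) (hh : height_fun h).

Lemma height_lt s t : s < t -> h s < h t.
Proof. by case: hh => + _ _; apply. Qed.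

Lemma height_le s t : s <= t -> h s <= h t.
Proof. by rewrite le_eqVlt => /orP[/eqP->|/height_lt/ltW]. Qed.

Lemma height_below t a : a < h t -> exists2 s, s < t & h s = a.
Proof.
by move=> at_; case: hh => _ /(_ t) im _; have : below (h t) a by []; rewrite -im.
Qed.

Lemma below_height_inj t x y : x < t -> y < t -> h x = h y -> x = y.
Proof.
move=> xt yt hxy; have /orP[] := below_comparable xt yt;
by rewrite le_eqVlt => /orP[/eqP //|/height_lt]; rewrite hxy ltxx.
Qed.

Lemma level_antichain a : antichain [set t | h t = a].
Proof.
move=> s t /= hs ht; apply: contraNN => /orP[];
by rewrite le_eqVlt => /orP[/eqP->//|/height_lt]; rewrite hs ht ltxx.
Qed.

(** Countably many levels, each an antichain, cover [U]. *)
Lemma bounded_special (c : W) (U : set T) :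
  (forall t, U t -> h t <= c) -> special U.
Proof.
move=> Uc.
have [||e eP] := @countable_enum _ (below c `|` [set c]).
- exact: countableU (below_countable hW c) (countable1 _).
- by exists c; right.
have {}eP : forall x, x <= c -> exists n, e n = x.
  by move=> x; rewrite le_eqVlt => /orP[/eqP->|xc]; apply: eP; [right|left].
exists (fun n => U `&` [set t | h t = e n]).
  by move=> n s t [_ hs] [_ ht]; exact: level_antichain hs ht.
apply/seteqP; split=> [t Ut|t [n _ []//]].
by have [n en] := eP _ (Uc t Ut); exists n.
Qed.

Lemma nonstationary_NS (C : set W) (E : set T) :
  club C -> (forall t, E t -> ~ C (h t)) -> NS T E.
Proof.
move=> [unb clos] EC.
have /choice[f fP] t : exists s, E t ->
    (t != \bot -> s < t) /\ forall c, C c -> c < h t -> c <= h s.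
  have [Et|nEt] := pselect (E t); last by exists \bot => /nEt.
  have [->|t0] := eqVneq t \bot.
    exists \bot => _; split=> // c _ /height_below[s].
    by rewrite ltx0.
  have [[c0 c0P]|no] := pselect (C `&` below (h t) !=set0).
    (* Since [h t] is not in the closed set [C], it is not the supremum of the part of [C] below
       it. *)
    have [g [gt gub]] : exists g, g < h t /\ ubound (C `&` below (h t)) g.
      apply: contrapT => no; apply: (EC t Et); apply: clos; first by exists c0.
      split=> [c [_ /ltW//]|u uub]; rewrite leNgt; apply/negP => ut.
      by apply: no; exists u.
    have [s st hs] := height_below gt.
    by exists s => _; split=> // c Cc ct; rewrite hs; apply: gub.
  (* With no point of [C] below [h t], the root meets the bound vacuously. *)
  exists \bot => _; split=> [_|c Cc ct]; first by rewrite lt0x.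
  by case: no; exists c.
exists f => [t Et t0|s]; first by have [+ _] := fP t Et; apply.
(* Pick [c] in [C] strictly above [h s]: a node of the fibre over [s] higher than [c] would force
   [c <= h s]. *)
have [b sb] := lt_exists hW (h s).
have [c Cc bc] := unb b.
apply: (@bounded_special c) => t [Et /= fts].
have [_ tP] := fP t Et; rewrite leNgt; apply/negP => ct.
have := tP c Cc ct; rewrite fts leNgt => /negP; apply.
exact: lt_le_trans sb bc.
Qed.

(** * Transfer between the two diamond principles *)

Lemma diamond_tree_diamond (B : set T) :
  cofinal_branch W B -> diamond W -> tree_diamond T.
Proof.
move=> [Bchain Blev] [D Dbelow DP].
have /choice[b bP] a : exists t, B t /\ h t = a.
  by have [t [Bt ta]] := Blev a; exists t; split=> //; case: hh => _ _ <-.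
have Bb a : B (b a) by have [] := bP a.
have hb a : h (b a) = a by have [] := bP a.
have blt u v : u < v -> b u < b v.
  move=> uv; have [|] := Bchain _ _ (Bb u) (Bb v); rewrite le_eqVlt.
    by move=> /orP[/eqP E|//]; move: uv; rewrite -(hb u) -(hb v) E ltxx.
  case/orP=> [/eqP E|/height_lt]; first by move: uv; rewrite -(hb u) -(hb v) E ltxx.
  by rewrite !hb ltNge ltW.
(* Predecessors of [b a] are again values of [b], because [b a] has only one predecessor of each
   height. *)
have bh s a : s < b a -> b (h s) = s.
  move=> sa; apply: (@below_height_inj (b a)) => //.
  by apply: blt; rewrite -[ltRHS]hb; exact: height_lt.
exists (fun t => [set s | s < t /\ D (h t) (h s)]) => [t s []//|X].
set E := [set t | _] => -[f freg fspec].
have EP a : [set x | X (b x)] `&` below a = D a -> E (b a).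
  move=> XD; apply/seteqP; split=> [s [Xs sa]|s [sa]].
    split=> //; rewrite hb -XD; split=> /=; first by rewrite (bh _ a).
    by rewrite /below /= -[ltRHS]hb; exact: height_lt.
  by rewrite hb -XD => -[/= + _]; rewrite (bh _ a).
have fib s : countable [set a | E (b a) /\ f (b a) = s].
  have [A Aanti AE] := fspec s.
  have -> : [set a | E (b a) /\ f (b a) = s] = \bigcup_n [set a | A n (b a)].
    apply/seteqP; split=> [a [Ea fa]|a [n _ An]].
      have [n _ An] : (\bigcup_n A n) (b a) by rewrite -AE.
      by exists n.
    by have : (\bigcup_n A n) (b a); [exists n|rewrite -AE => -[]].
  (* An antichain contains [b a] for at most one [a], so even a constant map is injective on these
     indices. *)
  apply: bigcup_countable => // n _; apply/countable_injP; exists (fun=> 0%N).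
  move=> u v /set_mem/= Au /set_mem/= Av _; apply: contrapT => /eqP uv.
  have buv : b u != b v by apply: contra uv => /eqP E'; rewrite -(hb u) E' hb.
  have := Aanti n _ _ Au Av buv.
  rewrite /Order.comparable; have [|] := Bchain _ _ (Bb u) (Bb v) => ->;
  by rewrite ?orbT.
(* [H c] exceeds every index [a] with [b a] in [E] that [f] sends to [b c]; a guessing point closed
   under [H] will contradict this. *)
have /choice[H HP] c := countable_strict_ub hW (fib (b c)).
have [w0 _] := countable_strict_ub hW (@countable0 W).
(* The bound [w0 < a] keeps [b a] away from the root, where regressivity says nothing. *)
have [a [Sa [w0a aP]]] := DP [set x | X (b x)] _ (club_closure_points hW w0 H).
have ba0 : b a != \bot.
  apply/eqP => ba; move: w0a; rewrite -[a]hb ba => /height_below[s].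
  by rewrite ltx0.
have fba := freg _ (EP a Sa) ba0.
have hfa : h (f (b a)) < a by rewrite -[ltRHS]hb; exact: height_lt.
have : a < H (h (f (b a))) by apply: HP; split; [exact: EP|rewrite (bh _ a)].
by rewrite ltNge ltW // aP.
Qed.

(* Kunen: if for each [n] the sequence read off the [n]-th node of every level
   failed at [X n], then coding all the [X n] into one subset of [T] would
   contradict the guessing property of [D]. *)
Lemma tree_diamond_diamond :
  (forall a : W, countable [set t | h t = a]) -> tree_diamond T -> diamond W.
Proof.
move=> clev [D Dbelow DP].
have [e einj] := coding_exists hW.
have /choice[nd ndP] a : exists g : nat -> T, forall t, h t = a -> exists n, g n = t.
  have [ne|no] := pselect ([set t | h t = a] !=set0).
    exact: countable_enum (clev a) ne.
  by exists (fun=> \bot) => u hu; case: no; exists u.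
pose D' n a := [set b | b < a /\ exists2 s, D (nd a n) s & h s = e (b, n)].
apply: contrapT => nd'.
have /choice[X XP] n : exists X : set W, ~ stationary [set a | X `&` below a = D' n a].
  apply: contrapT => no; apply: nd'; exists (D' n) => [a b []//|X].
  by apply: contrapT => nX; apply: no; exists X.
have /choice[C CP] n : exists C, club C /\
    forall a, C a -> X n `&` below a <> D' n a.
  apply: contrapT => no; apply: (XP n) => C clubC; apply: contrapT => dis.
  by apply: no; exists C; split=> // a Ca XD; apply: dis; exists a.
have /choice[H HP] b : exists u, forall n, e (b, n) < u.
  have [|u uP] := @countable_strict_ub _ _ hW (range (fun n => e (b, n))).
    exact/(card_le_trans (card_image_le _ _))/countableP.
  by exists u => n; apply: uP; exists n.
have [w0 _] := countable_strict_ub hW (@countable0 W).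
(* Index 0 holds the points closed under [H], hence under coding by [e]; index [m.+1] holds the club
   where the [m]-th sequence misses [X m]. *)
pose C0 n := if n is m.+1 then C m
             else [set a | w0 < a /\ forall b, b < a -> H b < a].
have clubC0 n : club (C0 n).
  by case: n => [|n] /=; [exact: club_closure_points|case: (CP n)].
(* Membership in [Y] depends on the height alone, so one correct guess of [Y] at [t] determines
   every [X n] below [h t]. *)
pose Y := [set s | exists n b, h s = e (b, n) /\ X n b].
apply: (DP Y); apply: (nonstationary_NS (club_bigcap hW clubC0)) => t /= YD Ct.
have [_ cl] := Ct 0%N I.
(* As [t] is the [n]-th node of its level, the [n]-th sequence guesses [X n] at [h t], which lies in
   [C n]. *)
have [n ndt] := ndP (h t) t erefl.
have [_ /(_ (h t) (Ct n.+1 I))] := CP n; apply.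
rewrite /D' ndt -YD; apply/seteqP; split=> [b [Xb bt]|b [bt]].
  (* Closure of [h t] under [H] puts the code of [b] below [h t], so [t] has a predecessor at that
     height. *)
  split=> //; have [s st hs] : exists2 s, s < t & h s = e (b, n).
    by apply: height_below; apply: lt_trans (HP b n) (cl _ bt).
  by exists s => //; split=> //; exists n, b.
by case=> s [[m [b' [-> Xb']]] _] /einj[eb em]; split=> //; rewrite -eb -em.
Qed.

End Tree.

Theorem corollary3p20
    (dW : Order.disp_t) (W : orderType dW) (hW : is_omega1 W)
    (dT : Order.disp_t) (T : bPOrderType dT)
    (hT : is_tree T) (hheight : has_height T W)
    (hbranch : exists B : set T, cofinal_branch W B) :
  (diamond W -> tree_diamond T) /\
  (is_omega1_tree T W -> (diamond W <-> tree_diamond T)).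
Proof.
have [h hh] := height_exists hW hT hheight.
have [B Bbranch] := hbranch.
have imp := diamond_tree_diamond hW hT hh Bbranch.
split=> // -[_ _ clev]; split=> //.
apply: (tree_diamond_diamond hW hh) => a.
rewrite (_ : [set t | _] = level T a) //.
by case: hh => _ _ lev; apply/seteqP; split=> t /lev.
Qed.
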